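(* Let $p,q,r\in\mathbb{Q}$ with $x^3-px^2-qx-r$ irreducible over $\mathbb{Q}$, let $\alpha$ be a real root of it whose modulus is strictly larger than the moduli of the two remaining roots $\alpha_2,\alpha_3$. Let $z$ be a nonzero integer such that $|z+\alpha^2|>|z+\alpha_2^2|$ and $|z+\alpha^2|>|z+\alpha_3^2|$, and such that $\mu_n^{(2)}\neq 0$ for all $n\ge 1$, where $\mu_n^{(0)},\mu_n^{(1)},\mu_n^{(2)}\in\mathbb{Q}$ are defined by $(z+\alpha^2)^n=\mu_n^{(0)}+\mu_n^{(1)}\alpha+\mu_n^{(2)}\alpha^2$. Then $$\lim_{n\to\infty}\frac{\mu_n^{(0)}}{\mu_n^{(2)}}=\frac{r}{\alpha},\qquad \lim_{n\to\infty}\frac{\mu_n^{(1)}}{\mu_n^{(2)}}=\alpha-p.$$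
   Context: The rationals $\mu_n^{(i)}$ (Cerruti polynomials) are uniquely determined since $1,\alpha,\alpha^2$ are linearly independent over $\mathbb{Q}$; they are obtained by reducing powers of $\alpha$ with $\alpha^3=p\alpha^2+q\alpha+r$. *)

(* Defs.v *)
From HB Require Import structures.
From mathcomp Require Import all_boot all_order all_algebra.
From mathcomp Require Import complex.
From mathcomp Require Import all_classical all_reals all_analysis.

Set Implicit Arguments.
Unset Strict Implicit.
Unset Printing Implicit Defensive.

Import Order.TTheory GRing.Theory Num.Theory.
Import numFieldNormedType.Exports.

Local Open Scope ring_scope.

Definition cubic (p q r : rat) : {poly rat} :=
  'X^3 - p *: 'X^2 - q *: 'X - r%:P.

(* Main.v *)
Require Import Defs.
From HB Require Import structures.
From mathcomp Require Import all_boot all_order all_algebra.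
From mathcomp Require Import complex.
From mathcomp Require Import all_classical all_reals all_analysis.
From mathcomp Require Import ring.

Set Implicit Arguments.
Unset Strict Implicit.
Unset Printing Implicit Defensive.

Import Order.TTheory GRing.Theory Num.Theory.
Import numFieldNormedType.Exports.

Local Open Scope classical_set_scope.
Local Open Scope ring_scope.
Local Open Scope complex_scope.

(** Write [b_i = z + alpha_i ^+ 2] with [alpha_1 = alpha], and let [f_n] be the
quadratic with coefficients [mu0 n, mu1 n, mu2 n].  By irreducibility
[f_n (alpha_i) = b_i ^+ n] for all three conjugates, and these are distinct.
Interpolating at [alpha_2] and [alpha_3] only, the numbers
[d_n = mu0 n - alpha_2 alpha_3 mu2 n] and
[e_n = mu1 n + (alpha_2 + alpha_3) mu2 n] are linear combinations of
[b_2 ^+ n] and [b_3 ^+ n], hence negligible with respect to [b_1 ^+ n].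
As [b_1 ^+ n = f_n (alpha)
  = d_n + e_n alpha + mu2 n (alpha - alpha_2) (alpha - alpha_3)],
they are also negligible with respect to [mu2 n]; by Vieta
[alpha_2 alpha_3 = r / alpha] and [alpha_2 + alpha_3 = p - alpha]. *)

(** If [p] did not divide [q], irreducibility would make them coprime; a Bezout relation survives
    the map to [K] and excludes a common root there. *)
Lemma irreducible_dvdp_root (F : fieldType) (K : idomainType)
    (f : {rmorphism F -> K}) (p q : {poly F}) (x : K) :
  irreducible_poly p -> root (map_poly f p) x -> root (map_poly f q) x ->
  p %| q.
Proof.
move=> p_irr px qx; apply: contraT; rewrite -irreducible_poly_coprime //.
by rewrite -(coprimep_map f) => /coprimep_root/(_ px); rewrite (rootP qx) eqxx.
Qed.

Lemma irreducible_deriv_nroot (F : fieldType) (K : idomainType)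
    (f : {rmorphism F -> K}) (p : {poly F}) (x : K) :
  irreducible_poly p -> p^`() != 0 -> root (map_poly f p) x ->
  ~~ root (map_poly f p^`()) x.
Proof.
move=> p_irr dp_neq0 px; apply/negP => /(irreducible_dvdp_root p_irr px).
move/(dvdp_leq dp_neq0); rewrite leqNgt lt_size_deriv //.
by rewrite -size_poly_gt0; case: p_irr => /ltnW.
Qed.

Lemma map_cubic (K : numFieldType) (p q r : rat) :
  map_poly ratr (cubic p q r) =
  'X^3 - ratr p *: 'X^2 - ratr q *: 'X - (ratr r)%:P :> {poly K}.
Proof.
by rewrite /cubic !rmorphB /= !map_polyZ /= !map_polyXn map_polyX map_polyC.
Qed.

Lemma deriv_cubic_neq0 (p q r : rat) : (cubic p q r)^`() != 0.
Proof.
apply/eqP => /(congr1 (fun P : {poly rat} => P`_2)).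
by rewrite /cubic !coefE /= !(mulr0, subr0).
Qed.

Lemma cubic_vieta (K : numFieldType) (p q r : rat) (a b c : K) :
  map_poly ratr (cubic p q r) =
    ('X - a%:P) * ('X - b%:P) * ('X - c%:P) ->
  ratr p = a + b + c /\ ratr r = a * b * c.
Proof.
rewrite map_cubic => abcE.
have : 'X^3 - ratr p *: 'X^2 - ratr q *: 'X - (ratr r)%:P =
  'X^3 - (a + b + c) *: 'X^2 - (- (a * b + a * c + b * c)) *: 'X
    - (a * b * c)%:P :> {poly K}.
  by rewrite abcE -!mul_polyC !(polyCN, polyCD, polyCM); ring.
move=> E; split.
  move/(congr1 (fun P : {poly K} => P`_2)): E.
  by rewrite !coefE /= !mulr1 !mulr0 !subr0 !sub0r => /oppr_inj.
move/(congr1 (fun P : {poly K} => P`_0)): E.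
by rewrite !coefE /= !mulr0 !subr0 !sub0r => /oppr_inj.
Qed.

(** Separability: a double root would also be a root of the derivative, whose degree is too small
    for the irreducible cubic to divide it. This makes the two interpolation nodes distinct. *)
Lemma cubic_roots_neq (K : numFieldType) (p q r : rat) (a b c : K) :
  irreducible_poly (cubic p q r) ->
  map_poly ratr (cubic p q r) =
    ('X - a%:P) * ('X - b%:P) * ('X - c%:P) ->
  b != c.
Proof.
move=> irr abcE; apply/eqP => bc.
have rb : root (map_poly ratr (cubic p q r) : {poly K}) b.
  by rewrite abcE !rootM !root_XsubC eqxx orbT.
have := irreducible_deriv_nroot irr (deriv_cubic_neq0 p q r) rb.
rewrite -deriv_map abcE -bc -mulrA !derivM /root.
by rewrite !(hornerXsubC, hornerD, hornerM) subrr !(mul0r, mulr0, addr0) eqxx.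
Qed.

Lemma complex_normE (R : rcfType) (x : R[i]) : `|x| = (complex.Re `|x|)%:C.
Proof. by rewrite normc_def. Qed.

Lemma norm_real_complex (R : rcfType) (x : R) : `|x%:C| = `|x|%:C.
Proof. by rewrite normc_def /= expr0n addr0 sqrtr_sqr. Qed.

(** Norms in [R[i]] are themselves elements of [R[i]]; taking [complex.Re] of them bounds [u] by a
    sum of two real geometric sequences, so that the squeeze takes place in [R]. *)
Lemma cvg0_complex_geometric (R : realType) (u : nat -> R) (a b x y : R[i]) :
  `|x| < 1 -> `|y| < 1 ->
  (forall n, (u n)%:C = a * x ^+ n + b * y ^+ n) ->
  u n @[n --> \oo] --> 0.
Proof.
have geo0 (c w : R[i]) : `|w| < 1 ->
    complex.Re `|c| * complex.Re `|w| ^+ n @[n --> \oo] --> 0.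
  move=> w1; apply: cvg_geometric.
  by rewrite ger0_norm -?ltcR -?lecR -complex_normE // normr_ge0.
move=> x1 y1 uE; apply/norm_cvg0P.
apply: (@squeeze_cvgr _ _ _ _ (fun=> 0)
  (fun n => complex.Re `|a| * complex.Re `|x| ^+ n
          + complex.Re `|b| * complex.Re `|y| ^+ n)).
- near=> n; rewrite normr_ge0 /= -lecR -norm_real_complex uE.
  rewrite rmorphD !rmorphM !rmorphXn /= -!complex_normE.
  by rewrite -!normrX -!normrM ler_normD.
- exact: cvg_cst.
- by rewrite -[X in _ --> X](addr0 0); apply: cvgD; apply: geo0.
Unshelve. all: by end_near. Qed.

Lemma cvg0_ratio (R : realType) (B d e m : nat -> R) (s K : R) :
  K != 0 -> (forall n, B n != 0) ->
  (forall n, B n = d n + e n * s + m n * K) ->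
  d n / B n @[n --> \oo] --> 0 -> e n / B n @[n --> \oo] --> 0 ->
  d n / m n @[n --> \oo] --> 0 /\ e n / m n @[n --> \oo] --> 0.
Proof.
move=> K0 B0 BE dB eB.
(* Dividing the relation [BE] by [B n] leaves only the term in [m n] in the limit, so [m] grows like
   [B / K]. *)
have mB : m n / B n @[n --> \oo] --> 1 / K.
  have -> : (fun n => m n / B n) =
      (fun n => (1 - d n / B n - e n / B n * s) * K^-1).
    apply/funext => n; have := BE n; have := B0 n => Bn0 BnE.
    have -> : m n = (B n - d n - e n * s) / K by rewrite BnE; field.
    by field; rewrite Bn0 K0.
  have -> : 1 / K = (1 - 0 - 0 * s) / K by rewrite mul0r !subr0.
  apply: cvgM; last exact: cvg_cst.
  by apply: cvgB; [apply: cvgB | apply: cvgM] => //; exact: cvg_cst.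
have quot (v : nat -> R) : v n / B n @[n --> \oo] --> 0 ->
    v n / m n @[n --> \oo] --> 0.
  move=> vB; have -> : (fun n => v n / m n) =
      (fun n => (v n / B n) * (m n / B n)^-1).
    (* The identity also holds where [m n = 0], both sides being 0 by the convention for
       inverses. *)
    by apply/funext => n; rewrite invfM invrK [_^-1 * _]mulrC mulrA mulfVK.
  rewrite -[X in _ --> X](mul0r (1 / K)^-1); apply: cvgM => //.
  by apply: cvgV => //; rewrite mul1r invr_eq0.
by split; apply: quot.
Qed.

Theorem theorem3 (R : realType) (p q r : rat) (alpha : R) (alpha2 alpha3 : R[i])
    (z : int) (mu0 mu1 mu2 : nat -> rat)
    (cubic_irr : irreducible_poly (cubic p q r))
    (cubic_roots : map_poly ratr (cubic p q r) =
       ('X - (alpha%:C)%:P) * ('X - alpha2%:P) * ('X - alpha3%:P) :> {poly R[i]})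
    (alpha_gt2 : `|alpha2| < `|alpha%:C|)
    (alpha_gt3 : `|alpha3| < `|alpha%:C|)
    (z_neq0 : z != 0)
    (z_gt2 : `|z%:~R + alpha2 ^+ 2| < `|z%:~R + alpha%:C ^+ 2|)
    (z_gt3 : `|z%:~R + alpha3 ^+ 2| < `|z%:~R + alpha%:C ^+ 2|)
    (mu_def : forall n : nat, (z%:~R + alpha ^+ 2) ^+ n =
       ratr (mu0 n) + ratr (mu1 n) * alpha + ratr (mu2 n) * alpha ^+ 2)
    (mu2_neq0 : forall n : nat, (1 <= n)%N -> mu2 n != 0) :
  (ratr (mu0 n) / ratr (mu2 n) : R) @[n --> \oo] --> ratr r / alpha /\
  (ratr (mu1 n) / ratr (mu2 n) : R) @[n --> \oo] --> alpha - ratr p.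
Proof.
have ratrC (x : rat) : (ratr x : R)%:C = ratr x by rewrite (fmorph_rat _ x).
(* Stated for variables: [rmorphM] would unfold [ratr] into a quotient. *)
have quadC (x y w a : R) : (x + y * a + w * a ^+ 2)%:C =
    x%:C + y%:C * a%:C + w%:C * a%:C ^+ 2.
  by rewrite !rmorphD !rmorphM.
have subMC (x y w : R) : (x - y * w)%:C = x%:C - y%:C * w%:C.
  by rewrite rmorphB rmorphM.
have divC (x y : R) : (x / y)%:C = x%:C / y%:C by rewrite fmorph_div.
have [pE rE] := cubic_vieta cubic_roots.
have a23 := cubic_roots_neq cubic_irr cubic_roots.
have a_neq0 : alpha%:C != 0 by rewrite -normr_gt0 (le_lt_trans _ alpha_gt2).
have alpha_neq0 : alpha != 0 by apply: contraNneq a_neq0 => ->.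
pose b (x : R[i]) := z%:~R + x ^+ 2.
have b1E : (z%:~R + alpha ^+ 2)%:C = b alpha%:C.
  by rewrite rmorphD rmorphXn rmorph_int.
have b1_neq0 : b alpha%:C != 0 by rewrite -normr_gt0 (le_lt_trans _ z_gt2).
have mu_conj x n : root (map_poly ratr (cubic p q r)) x ->
    b x ^+ n = ratr (mu0 n) + ratr (mu1 n) * x + ratr (mu2 n) * x ^+ 2.
  (* The defining relation of the [mu]s at [alpha] says that the rational polynomial [T] vanishes
     there; the cubic then divides [T], which carries the relation to every conjugate. *)
  pose T : {poly rat} := (z%:~R%:P + 'X^2) ^+ n
    - ((mu0 n)%:P + mu1 n *: 'X + mu2 n *: 'X^2).
  have TE y : (map_poly ratr T).[y] = b y ^+ n
      - (ratr (mu0 n) + ratr (mu1 n) * y + ratr (mu2 n) * y ^+ 2).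
    rewrite /T rmorphB rmorphXn !rmorphD /= !map_polyZ !map_polyC map_polyXn.
    by rewrite map_polyX /= rmorph_int !hornerE.
  have /dvdpP [Q TQ] : cubic p q r %| T.
    apply: (@irreducible_dvdp_root _ _ ratr _ _ alpha%:C) => //.
      by rewrite cubic_roots !rootM root_XsubC eqxx.
    by rewrite /root TE -b1E -rmorphXn mu_def /= quadC !ratrC subrr.
  move=> /rootP x0; apply/eqP; rewrite -subr_eq0 -TE TQ rmorphM hornerM x0.
  by rewrite mulr0.
have mu_b2 n := @mu_conj alpha2 n.
have mu_b3 n := @mu_conj alpha3 n.
rewrite cubic_roots !rootM !root_XsubC eqxx orbT /= in mu_b2.
rewrite cubic_roots !rootM !root_XsubC eqxx orbT /= in mu_b3.
have div_lt1 x : `|b x| < `|b alpha%:C| -> `|b x / b alpha%:C| < 1.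
  by move=> bx; rewrite normf_div ltr_pdivrMr ?normr_gt0 // mul1r.
pose B n : R := (z%:~R + alpha ^+ 2) ^+ n.
(* The coefficients are written through [r / alpha] and [alpha - p] so that [d] and [e] are real
   even when [alpha2] and [alpha3] are not. *)
pose d n : R := ratr (mu0 n) - ratr r / alpha * ratr (mu2 n).
pose e n : R := ratr (mu1 n) - (alpha - ratr p) * ratr (mu2 n).
have BC n : (B n)%:C = b alpha%:C ^+ n by rewrite rmorphXn /= b1E.
have d23 : alpha2 - alpha3 != 0 by rewrite subr_eq0.
have dB0 : d n / B n @[n --> \oo] --> 0.
  (* Lagrange coefficients: [d n + e n * X] is the line taking the values [b alpha2 ^+ n] at
     [alpha2] and [b alpha3 ^+ n] at [alpha3]; [d n] is its value at 0, and [e n] below its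
     slope. *)
  apply: (@cvg0_complex_geometric _ _ (- alpha3 / (alpha2 - alpha3))
    (alpha2 / (alpha2 - alpha3)) _ _ (div_lt1 _ z_gt2) (div_lt1 _ z_gt3)) => n.
  rewrite !expr_div_n (mu_b2 n isT) (mu_b3 n isT).
  rewrite divC BC subMC (divC _ alpha) !ratrC rE.
  by field; rewrite expf_neq0 // d23 a_neq0.
have eB0 : e n / B n @[n --> \oo] --> 0.
  apply: (@cvg0_complex_geometric _ _ (alpha2 - alpha3)^-1
    (- (alpha2 - alpha3)^-1) _ _ (div_lt1 _ z_gt2) (div_lt1 _ z_gt3)) => n.
  rewrite !expr_div_n (mu_b2 n isT) (mu_b3 n isT).
  rewrite divC BC subMC rmorphB /= !ratrC pE.
  by field; rewrite expf_neq0 // d23.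
(* A real form of [(alpha - alpha2) * (alpha - alpha3)], nonzero since [alpha] strictly dominates
   the other roots. *)
pose K : R := ratr r / alpha - (ratr p - alpha - alpha) * alpha.
have K_neq0 : K != 0.
  have KE : K%:C = (alpha%:C - alpha2) * (alpha%:C - alpha3).
    rewrite subMC (divC _ alpha) !rmorphB /= !ratrC rE pE.
    by field.
  apply: contra_neq (_ : K%:C != 0) => [-> //|].
  rewrite KE mulf_neq0 // subr_eq0; apply/eqP => aE.
    by rewrite aE ltxx in alpha_gt2.
  by rewrite aE ltxx in alpha_gt3.
have B_neq0 n : B n != 0.
  apply: contra_neq (_ : (B n)%:C != 0) => [-> //|].
  by rewrite BC expf_neq0.
have BE n : B n = d n + e n * alpha + ratr (mu2 n) * K.
  by rewrite /B mu_def /d /e /K; field.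
have [dmu emu] := cvg0_ratio K_neq0 B_neq0 BE dB0 eB0.
have shift (m v : nat -> R) (l : R) : (forall n, (1 <= n)%N -> m n != 0) ->
    (v n - l * m n) / m n @[n --> \oo] --> 0 -> v n / m n @[n --> \oo] --> l.
  (* Index 0 is dropped because [mu2 0 = 0]: there the quotient takes the default value 0 and cannot
     be split as error plus [l]. *)
  move=> m0 vm; rewrite -(cvg_shiftS (fun n => v n / m n)).
  have -> : (fun n => v n.+1 / m n.+1) =
      (fun n => (v n.+1 - l * m n.+1) / m n.+1 + l).
    by apply/funext => n; rewrite mulrBl mulfK ?m0 // subrK.
  suff : (v n.+1 - l * m n.+1) / m n.+1 + l @[n --> \oo] --> 0 + l.
    by rewrite add0r.
  apply: cvgD; last exact: cvg_cst.
  by rewrite (cvg_shiftS (fun n => (v n - l * m n) / m n)).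
have ratr_mu2 n : (1 <= n)%N -> ratr (mu2 n) != 0 :> R.
  by move=> n1; rewrite fmorph_eq0 mu2_neq0.
by split; apply: shift.
Qed.
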